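(* There exists a covering system of the integers whose moduli are all odd and greater than $1$, in which exactly five congruences have modulus $21$ and the congruences with moduli different from $21$ have pairwise distinct moduli.
   Context: A covering system is a finite collection of congruences $r_i\pmod{m_i}$ such that every integer satisfies at least one of them. *)

(* Defs.v *)
From Stdlib Require Import ZArith List.
Import ListNotations.
Open Scope Z_scope.

(* The congruence [x = residue (mod modulus)]. *)
Record congruence : Set := Congruence { residue : Z; modulus : Z }.

Definition satisfies (x : Z) (c : congruence) : Prop :=
  (modulus c | x - residue c).

(* Congruences with equal moduli and residues equal modulo that modulus are the
   same congruence; a pair representing it uniquely (for a positive modulus). *)
Definition residue_class (c : congruence) : Z * Z :=
  (residue c mod modulus c, modulus c).

(* A finite collection of congruences is a list that never repeats a
   congruence, not even through different representatives of its residue, so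
   that counting list entries counts distinct congruences. *)
Definition covering_system (s : list congruence) : Prop :=
  (forall c, In c s -> 0 < modulus c) /\
  NoDup (map residue_class s) /\
  (forall x : Z, exists c, In c s /\ satisfies x c).

(* Main.v *)
(* If a residue class has f free multipliers d, then the moduli d p cover f of
   its p subclasses; one of the remaining subclasses is treated in the same way with
   the moduli d p^2, d p^3, ... (a chain), and in the others the multipliers d p become
   available as well.

   The moduli 3 and 7 and the five copies of 21 leave the class 2 mod 3 outside the
   column 0 mod 7, and the single class (1 mod 3, 1 mod 7).  Run a chain of powers of 3
   towards -1, respectively towards 1 (with the moduli 7 * 3^j), and in the class left
   over at each level a chain of powers of 5 towards 0: the moduli 5^i, 3 * 5^i and
   3^j * 5^i, respectively 5^i, 21 * 5^i, 7 * 3^j * 5^i and 35 * 5^(i-1), leave only the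
   columns 2, ..., 6 of the class 4 * 5^(i-1) mod 5^i in the class 2 mod 3.  There each
   m prime to 15 can be used with the six multipliers {1, 3, 3^j} * {1, 5^i}, with the
   same residue mod m at every level, and a finite table of such m covers these
   columns.  The ends of the chains are covered by moduli divisible by 23, which is
   possible because 23 <= 8 * 3 and the 3-chain runs up to 3^22. *)

Require Import Defs.
From Stdlib Require Import ZArith List.
From Stdlib Require Import Znumtheory Zpow_facts Lia.
Import ListNotations.
Open Scope Z_scope.

(** * Chinese remainders and uniqueness of factored moduli *)

Fixpoint prod (l : list Z) : Z :=
  match l with [] => 1 | m :: l => m * prod l end.

Fixpoint pairwise_coprime (l : list Z) : Prop :=
  match l with [] => True | m :: l => rel_prime m (prod l) /\ pairwise_coprime l end.

Lemma rel_prime_mul_divide m n z :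
  rel_prime m n -> (m | z) -> (n | z) -> (m * n | z).
Proof.
  intros Hmn [k ->] Hn.
  rewrite Z.mul_comm in Hn.
  apply Gauss in Hn; [|now apply rel_prime_sym].
  destruct Hn as [l ->]. exists l. ring.
Qed.

Lemma chinese_remainder a m b n :
  rel_prime m n -> exists r, (m | r - a) /\ (n | r - b).
Proof.
  intros H. destruct (rel_prime_bezout _ _ H) as [u v E].
  exists (a * (v * n) + b * (u * m)). split.
  - exists (u * (b - a)). replace (v * n) with (1 - u * m) by lia. ring.
  - exists (v * (a - b)). replace (u * m) with (1 - v * n) by lia. ring.
Qed.

Lemma chinese_remainder_list (cs : list congruence) :
  pairwise_coprime (map modulus cs) ->
  exists c, modulus c = prod (map modulus cs) /\
    forall x, Forall (satisfies x) cs -> satisfies x c.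
Proof.
  induction cs as [|[a m] cs IH]; simpl.
  - intros _. exists (Congruence 0 1). split; [reflexivity|].
    intros x _. apply Z.divide_1_l.
  - intros [Hm Hcs]. destruct (IH Hcs) as [[b n] [E Hc]]. simpl in E. subst n.
    destruct (chinese_remainder a m b _ Hm) as [r [Ha Hb]].
    exists (Congruence r (m * prod (map modulus cs))). split; [reflexivity|].
    intros x Hx. inversion Hx as [|? ? Hxa Hxcs]; subst.
    specialize (Hc x Hxcs). unfold satisfies in *; simpl in *.
    apply rel_prime_mul_divide; [exact Hm| |].
    + replace (x - r) with ((x - a) - (r - a)) by ring. now apply Z.divide_sub_r.
    + replace (x - r) with ((x - b) - (r - b)) by ring. now apply Z.divide_sub_r.
Qed.

(** The residues stay existential: beyond coverage, the system is judged by its moduli alone, and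
    these are explicit. *)
Lemma chinese_remainder_map (A : Type) (F : A -> list congruence) (l : list A) :
  (forall i, In i l -> pairwise_coprime (map modulus (F i))) ->
  exists s, map modulus s = map (fun i => prod (map modulus (F i))) l /\
    forall x i, In i l -> Forall (satisfies x) (F i) ->
      exists c, In c s /\ satisfies x c.
Proof.
  induction l as [|i l IH]; intros H.
  - exists []. split; [reflexivity|]. intros x i [].
  - destruct IH as [s [Es Hs]]; [intros; apply H; now right|].
    destruct (chinese_remainder_list (F i)) as [c [Ec Hc]]; [apply H; now left|].
    exists (c :: s). split; [simpl; now rewrite Ec, Es|].
    intros x k [->|Hk] Hx.
    + exists c. split; [now left|auto].
    + destruct (Hs x k Hk Hx) as [c' [? ?]]. exists c'. split; [now right|auto].
Qed.

(** If just one exponent were 0, p would divide a number prime to p; otherwise cancel p and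
    induct. *)
Lemma pow_mul_inj p a a' k k' :
  1 < p -> rel_prime p k -> rel_prime p k' ->
  p ^ Z.of_nat a * k = p ^ Z.of_nat a' * k' -> a = a' /\ k = k'.
Proof.
  intros Hp Hk Hk'.
  assert (Hnot : forall z, rel_prime p z -> ~ (p | z)).
  { intros z Hz Hd. apply rel_prime_bezout in Hz. destruct Hz as [u v E].
    assert (H1 : (p | 1)).
    { rewrite <- E. apply Z.divide_add_r; apply Z.divide_mul_r; [apply Z.divide_refl|exact Hd]. }
    apply Z.divide_1_r_nonneg in H1; lia. }
  revert a'. induction a as [|a IH]; intros [|a'] E;
    rewrite ?Nat2Z.inj_succ, ?Z.pow_succ_r in E by lia;
    change (Z.of_nat 0) with 0 in *; rewrite ?Z.pow_0_r in E.
  - split; [reflexivity|lia].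
  - exfalso. apply (Hnot k Hk). exists (p ^ Z.of_nat a' * k'). lia.
  - exfalso. apply (Hnot k' Hk'). exists (p ^ Z.of_nat a * k). lia.
  - destruct (IH a') as [-> ->]; [|now split].
    apply (Z.mul_reg_l _ _ p); [lia|]. rewrite !Z.mul_assoc. exact E.
Qed.

(** * The pattern on the columns 2, ..., 6 modulo 7 *)

(** The recursion follows [ms] and pads [rs] with 0, so the moduli are [ms] whatever [rs] is. *)
Fixpoint box (ms rs : list Z) : list congruence :=
  match ms with
  | [] => []
  | m :: ms => Congruence (hd 0 rs) m :: box ms (tl rs)
  end.

Lemma modulus_box ms rs : map modulus (box ms rs) = ms.
Proof. revert rs; induction ms; intros; simpl; f_equal; auto. Qed.

(* A row gives the factors of m and the residues modulo these factors for each of the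
   multipliers of m, in the order 1, 3, 3^j, 5^i, 3 * 5^i, 3^j * 5^i.  The rows without
   the factor 49 were found by a greedy computer search and cover the columns 2, ..., 5. *)
Definition table : list (list Z * list (list Z)) :=
  [([49], [[6]; [13]; [20]; [27]; [34]; [41]]);
   ([49;11], [[48;0]; [48;1]; [48;3]; [48;7]; [48;10]]);
   ([11], [[2]; [5]; [8]; [9]; [6]; [4]]);
   ([7;11], [[3;10]; [5;10]; [3;7]; [5;7]; [3;0]; [5;0]]);
   ([13], [[12]; [5]; [0]; [6]; [9]; [8]]);
   ([7;13], [[3;1]; [2;1]; [5;1]; [4;1]; [2;3]; [4;3]]);
   ([11;13], [[3;10]; [1;10]; [3;4]; [3;7]; [3;11]; [3;2]]);
   ([7;11;13], [[3;3;3]; [5;3;3]; [5;1;3]; [3;1;3]; [4;0;10]; [4;10;10]]);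
   ([17], [[1]; [5]; [14]; [2]; [0]; [7]]);
   ([7;17], [[2;15]; [2;6]; [2;4]; [2;12]; [2;9]; [2;13]]);
   ([11;17], [[1;11]; [1;10]; [1;8]; [1;3]; [1;16]; [1;13]]);
   ([13;17], [[4;11]; [11;11]; [7;11]; [2;11]; [7;8]; [11;8]]);
   ([7;11;17], [[2;0;10]; [2;10;10]; [2;7;10]; [2;10;3]; [2;0;3]; [2;7;3]]);
   ([7;13;17], [[2;10;11]; [2;10;8]; [2;4;8]; [2;2;8]; [2;10;16]; [4;11;4]]);
   ([11;13;17], [[1;7;4]; [1;2;4]; [1;4;4]; [1;7;12]; [1;4;12]; [1;2;12]]);
   ([7;11;13;17], [[5;1;11;4]; [3;1;11;4]; [5;1;11;12]; [3;1;11;12]; [2;10;11;16]; [2;0;11;16]]);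
   ([19], [[16]; [5]; [0]; [4]; [18]; [2]]);
   ([7;19], [[4;13]; [4;7]; [4;9]; [4;6]; [4;14]; [4;10]]);
   ([11;19], [[7;1]; [7;15]; [7;8]; [7;11]; [7;17]; [7;12]]);
   ([13;19], [[2;3]; [4;3]; [7;3]; [11;3]; [2;17]; [4;17]]);
   ([17;19], [[6;1]; [15;1]; [9;1]; [6;12]; [15;12]; [9;12]]);
   ([7;11;19], [[4;0;15]; [4;10;15]; [4;0;11]; [4;10;11]; [4;10;8]; [4;0;8]]);
   ([7;13;19], [[4;11;17]; [4;7;17]; [4;10;3]; [4;4;12]; [4;2;12]; [4;7;12]]);
   ([7;17;19], [[2;16;9]; [2;16;10]; [2;16;13]; [2;16;14]; [2;16;7]; [2;16;6]]);
   ([11;13;19], [[10;4;1]; [0;4;1]; [0;2;1]; [10;2;1]; [10;7;1]; [0;7;1]]);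
   ([11;17;19], [[1;6;11]; [1;15;11]; [1;9;11]; [1;15;8]; [1;6;8]; [1;9;8]]);
   ([13;17;19], [[11;12;1]; [11;12;12]; [7;16;17]; [4;16;11]; [2;16;11]; [7;16;11]]);
   ([7;11;13;19], [[4;0;11;1]; [4;10;11;1]; [4;10;11;12]; [4;0;11;12]; [4;1;11;15]; [4;1;2;15]]);
   ([7;11;17;19], [[2;0;16;12]; [2;10;16;12]; [2;0;16;8];
     [2;10;16;8]; [2;10;16;15]; [2;0;16;15]]);
   ([7;13;17;19], [[4;11;12;11]; [4;11;12;8]; [4;4;15;15]; [4;4;6;15]; [4;4;9;15]; [4;7;6;15]]);
   ([11;13;17;19], [[1;7;9;15]; [1;7;15;15]; [1;7;15;17]; [1;7;9;17]; [1;7;6;17]; [1;7;6;15]]);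
   ([7;11;13;17;19], [[3;1;2;9;15]; [5;1;2;9;15]; [3;1;2;6;15];
     [5;1;2;6;15]; [5;1;2;15;15]; [3;1;2;15;15]]);
   ([29], [[12]; [0]; [27]; [18]; [16]; [9]]);
   ([7;29], [[5;2]; [3;2]; [3;7]; [5;7]; [3;23]; [5;23]]);
   ([11;29], [[1;8]; [1;28]; [1;26]; [1;14]; [1;15]; [1;3]]);
   ([13;29], [[11;21]; [11;22]; [11;11]; [11;19]; [11;10]; [11;5]]);
   ([17;29], [[9;24]; [6;24]; [15;24]; [9;4]; [6;4]; [15;4]]);
   ([19;29], [[14;6]; [7;6]; [6;6]; [9;6]; [10;6]; [13;6]]);
   ([7;11;29], [[5;1;25]; [3;1;25]; [5;1;13]; [3;1;13]; [5;1;20]; [3;1;20]]);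
   ([7;13;29], [[5;11;1]; [3;11;1]; [3;11;17]; [5;11;17]; [3;4;22]; [5;4;22]]);
   ([7;17;29], [[3;6;17]; [5;6;17]; [3;9;17]; [5;9;17]; [5;15;17]; [3;15;17]]);
   ([7;19;29], [[5;6;21]; [3;6;21]; [3;6;11]; [5;6;11]; [3;6;19]; [5;6;19]]);
   ([11;13;29], [[1;4;10]; [1;4;1]; [1;4;5]; [1;4;21]; [1;4;19]; [1;4;11]]);
   ([11;17;29], [[1;9;10]; [1;15;10]; [1;6;10]; [1;9;5]; [1;15;5]; [1;6;5]]);
   ([11;19;29], [[1;15;6]; [1;6;1]; [1;6;22]; [1;14;11]; [1;14;1]; [1;14;21]]);
   ([13;17;29], [[2;9;22]; [7;9;22]; [7;15;22]; [2;15;22]; [7;6;22]; [2;6;22]]);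
   ([13;19;29], [[11;17;6]; [2;14;19]; [7;14;19]; [2;13;21]; [7;13;21]; [2;13;1]]);
   ([17;19;29], [[15;13;19]; [9;13;19]; [6;13;19]; [9;13;11]; [15;13;11]; [6;13;11]]);
   ([7;11;13;29], [[3;1;7;1]; [5;1;7;1]; [5;1;2;1]; [3;1;2;1]; [5;1;7;11]; [5;1;2;11]]);
   ([7;11;17;29], [[3;1;6;11]; [3;1;9;11]; [3;1;15;11]; [3;1;9;19]; [5;1;9;19]; [3;1;9;21]]);
   ([7;11;19;29], [[5;1;9;21]; [5;1;10;21]; [5;1;7;21]; [3;1;9;21]; [3;1;7;21]; [3;1;10;21]]);
   ([7;13;17;29], [[3;7;6;19]; [5;7;6;19]; [3;7;15;19]; [5;7;15;19]; [3;2;15;19]; [3;2;6;19]]);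
   ([7;13;19;29], [[5;2;7;19]; [5;2;9;19]; [5;2;10;19]])].

(* Only the head of an entry is compared with p, so the splitting factors have to come
   in the order in which the table lists them. *)
Definition restrict (p v : Z) (es : list (list congruence)) : list (list congruence) :=
  flat_map (fun e =>
    match e with
    | Congruence r m :: e' => if m =? p then if r =? v then [e'] else [] else [e]
    | [] => [e]
    end) es.

Definition residues (p : Z) : list Z := map Z.of_nat (seq 0 (Z.to_nat p)).

(* Not a boolean disjunction, which would be evaluated strictly and defeat pruning. *)
Fixpoint covered (ps : list Z) (es : list (list congruence)) : bool :=
  if existsb (fun e => match e with [] => true | _ => false end) es then true else
  match ps with
  | [] => false
  | p :: ps => forallb (fun v => covered ps (restrict p v es)) (residues p)
  end.

Definition met (x : Z) (es : list (list congruence)) : Prop :=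
  exists e, In e es /\ Forall (satisfies x) e.

Lemma restrict_met x p v es : (p | x - v) -> met x (restrict p v es) -> met x es.
Proof.
  intros Hv [e' [He' Hx]]. unfold restrict in He'.
  apply in_flat_map in He'. destruct He' as [e [He Hin]].
  destruct e as [|[r m] e]; simpl in Hin.
  - destruct Hin as [<-|[]]. exists []. split; [exact He|constructor].
  - destruct (Z.eqb_spec m p) as [->|]; [destruct (Z.eqb_spec r v) as [->|]|];
      simpl in Hin; [destruct Hin as [<-|[]]|destruct Hin|destruct Hin as [<-|[]]].
    + exists (Congruence v p :: e). split; [exact He|]. now constructor.
    + eexists. split; [exact He|exact Hx].
Qed.

Lemma in_residues p x : 0 < p -> In (x mod p) (residues p).
Proof.
  intros Hp. pose proof (Z.mod_pos_bound x p Hp) as Hm.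
  apply in_map_iff. exists (Z.to_nat (x mod p)).
  split; [lia|]. apply in_seq. lia.
Qed.

Lemma divide_sub_mod p x : 0 < p -> (p | x - x mod p).
Proof.
  intros Hp. exists (x / p). pose proof (Z.div_mod x p ltac:(lia)). lia.
Qed.

(** Soundness of the search: split on x mod p for each p in turn; an emptied entry has had all its
    congruences verified. *)
Lemma covered_met x ps es :
  Forall (fun p => 0 < p) ps -> covered ps es = true -> met x es.
Proof.
  intros Hps. revert es.
  assert (Hnil : forall es,
    existsb (fun e : list congruence => match e with [] => true | _ => false end) es = true ->
    met x es).
  { intros es H. apply existsb_exists in H. destruct H as [[|] [He E]]; [|discriminate].
    exists []. split; [exact He|constructor]. }
  induction Hps as [|p ps Hp Hps IH]; intros es H; simpl in H;
    destruct (existsb _ es) eqn:E; auto; [discriminate|].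
  rewrite forallb_forall in H. apply (restrict_met x p (x mod p)).
  - now apply divide_sub_mod.
  - apply IH, H, in_residues, Hp.
Qed.

Definition entries : list (list congruence) :=
  flat_map (fun t => map (box (fst t)) (snd t)) table.

(** Column 6 is split modulo 49: the first row takes 6, 13, ..., 41, and for 48 the second and third
    rows together hit all 11 residues modulo 11. *)
Lemma entries_cover :
  forallb (fun c => covered [11; 13; 17; 19; 29] (restrict 7 c entries)) [2; 3; 4; 5] = true /\
  forallb (fun v => covered [11] (restrict 49 (6 + 7 * v) (restrict 7 6 entries)))
    (residues 7) = true.
Proof. split; vm_compute; reflexivity. Qed.

Lemma entries_met x : 2 <= x mod 7 -> met x entries.
Proof.
  intros H. pose proof (Z.mod_pos_bound x 7 ltac:(lia)) as Hb.
  pose proof (divide_sub_mod 7 x ltac:(lia)) as Hd.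
  destruct entries_cover as [H1 H2]. rewrite forallb_forall in H1, H2.
  apply (restrict_met x 7 (x mod 7) _ Hd).
  destruct (Z.eq_dec (x mod 7) 6) as [E|E].
  - rewrite E in *. apply (restrict_met x 49 (6 + 7 * (x / 7 mod 7))).
    + exists (x / 7 / 7).
      pose proof (Z.div_mod x 7 ltac:(lia)). pose proof (Z.div_mod (x / 7) 7 ltac:(lia)). lia.
    + apply (covered_met x [11]); [repeat constructor|]. apply H2, in_residues. lia.
  - apply (covered_met x [11; 13; 17; 19; 29]); [repeat constructor|].
    apply H1. simpl. lia.
Qed.

Lemma table_rows : forallb (fun t => (length (snd t) <=? 6)%nat) table = true.
Proof. reflexivity. Qed.

Lemma table_met x :
  2 <= x mod 7 ->
  exists t k, In t table /\ (k < 6)%nat /\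
    Forall (satisfies x) (box (fst t) (nth k (snd t) [])).
Proof.
  intros H. destruct (entries_met x H) as [e [He Hx]].
  apply in_flat_map in He. destruct He as [t [Ht He]].
  apply in_map_iff in He. destruct He as [r [<- Hr]].
  destruct (In_nth _ _ [] Hr) as [k [Hk E]].
  exists t, k. split; [exact Ht|]. rewrite E. split; [|exact Hx].
  pose proof (proj1 (forallb_forall _ _) table_rows t Ht) as Hl.
  apply Nat.leb_le in Hl. lia.
Qed.

(** * Chains of powers of 3 and of 5 *)

Lemma divide_next_power p x s n :
  0 < p -> (p ^ Z.of_nat n | x - s) ->
  exists u, 0 <= u < p /\ (p ^ Z.of_nat (S n) | x - (s + u * p ^ Z.of_nat n)).
Proof.
  intros Hp [k E]. exists (k mod p). split; [now apply Z.mod_pos_bound|].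
  exists (k / p). rewrite Nat2Z.inj_succ, Z.pow_succ_r by lia.
  pose proof (Z.div_mod k p ltac:(lia)) as Hk. set (q := p ^ Z.of_nat n) in *.
  replace (x - (s + k mod p * q)) with ((x - s) - k mod p * q) by ring.
  rewrite E. replace (k mod p) with (k - p * (k / p)) by lia. ring.
Qed.

(* Along the chain s mod 3^a, the modulus 3^a covers the class [killed s a], and
   [kept s a] is the class left to the powers of 5; for a <= 1 it is just s. *)
Definition killed (s : Z) (a : nat) : Z :=
  match a with O => s | S n => s + 3 ^ Z.of_nat n end.

Definition kept (s : Z) (a : nat) : Z :=
  match a with S (S n) => s - 3 ^ Z.of_nat (S n) | _ => s end.

(** For b > 0 this residue modulo 5^b has the base-5 digit u in position b - 1 and zeros below
    it. *)
Definition digit (b : nat) (u : Z) : Z := u * 5 ^ Z.of_nat (pred b).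

(** Each level splits the class of s by the next ternary digit of x - s: 0 continues the chain, 1 is
    [killed], 2 is [kept]. *)
Lemma chain_3 x s n :
  (3 | x - s) ->
  (3 ^ Z.of_nat (S n) | x - s) \/
  exists j, (2 <= j <= S n)%nat /\
    ((3 ^ Z.of_nat j | x - killed s j) \/ (3 ^ Z.of_nat j | x - kept s j)).
Proof.
  intros H. induction n as [|n IH]; [now left|]. destruct IH as [IH|[j [Hj IH]]].
  - destruct (divide_next_power 3 x s (S n) ltac:(lia) IH) as [u [Hu Hd]].
    assert (u = 0 \/ u = 1 \/ u = 2) as [-> | [-> | ->]] by lia.
    + left. now replace (s + 0 * 3 ^ Z.of_nat (S n)) with s in Hd by ring.
    + right. exists (S (S n)). split; [lia|]. left. unfold killed.
      now rewrite Z.mul_1_l in Hd.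
    + right. exists (S (S n)). split; [lia|]. right. unfold kept.
      (* Modulo the next power the digit 2 acts as -1, as in [kept]. *)
      replace (x - (s - 3 ^ Z.of_nat (S n)))
        with ((x - (s + 2 * 3 ^ Z.of_nat (S n))) + 3 ^ Z.of_nat (S (S n))).
      { apply Z.divide_add_r; [exact Hd|apply Z.divide_refl]. }
      rewrite (Nat2Z.inj_succ (S n)), Z.pow_succ_r by lia. ring.
  - right. exists j. split; [lia|exact IH].
Qed.

(** In the second case u is the lowest nonzero base-5 digit of x, in position i - 1. *)
Lemma chain_5 x n :
  (5 ^ Z.of_nat n | x) \/
  exists i u, (1 <= i <= n)%nat /\ 1 <= u <= 4 /\ (5 ^ Z.of_nat i | x - digit i u).
Proof.
  induction n as [|n IH]; [left; apply Z.divide_1_l|]. destruct IH as [IH|[i [u [Hi H]]]].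
  - rewrite <- (Z.sub_0_r x) in IH.
    destruct (divide_next_power 5 x 0 n ltac:(lia) IH) as [u [Hu Hd]].
    destruct (Z.eq_dec u 0) as [->|].
    + left. now replace (x - (0 + 0 * 5 ^ Z.of_nat n)) with x in Hd by ring.
    + right. exists (S n), u. split; [lia|]. split; [lia|exact Hd].
  - right. exists i, u. split; [lia|exact H].
Qed.

(** This is why 1, 3 and 3^j can all serve as multipliers in the class kept at level j. *)
Lemma kept_below x s j a :
  (3 | x - s) -> (3 ^ Z.of_nat j | x - kept s j) -> a = O \/ a = 1%nat \/ a = j ->
  (3 ^ Z.of_nat a | x - kept s a).
Proof. intros H Hj [-> | [-> | ->]]; [apply Z.divide_1_l|exact H|exact Hj]. Qed.

Lemma power_below p x s a n :
  0 < p -> (a <= n)%nat -> (p ^ Z.of_nat n | x - s) -> (p ^ Z.of_nat a | x - s).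
Proof.
  intros Hp Ha H. apply Z.divide_trans with (2 := H).
  exists (p ^ Z.of_nat (n - a)). rewrite <- Z.pow_add_r by lia. f_equal. lia.
Qed.

(** * The covering *)

(** All moduli 3^a * 5^b * m with one m, the product of [factors]; [place a b] holds the residues
    modulo 3^a, 5^b and the factors. *)
Record kind := Kind { factors : list Z; place : nat -> nat -> Z * Z * list Z }.

Definition cell (i : nat * nat * kind) : list congruence :=
  let '(a, b, k) := i in
  let '(r3, r5, rs) := place k a b in
  Congruence r3 (3 ^ Z.of_nat a) :: Congruence r5 (5 ^ Z.of_nat b) :: box (factors k) rs.

Definition size (i : nat * nat * kind) : Z := prod (map modulus (cell i)).

(* The kind fixes the part m of the modulus 3^a * 5^b * m.  At b = 0, the kinds 1 and 7
   kill a class of the 3-chain; the residue modulo 3^0 or 5^0 is arbitrary. *)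
Definition kind_1 : kind := Kind [] (fun a b =>
  match b with
  | O => (killed (-1) a, 0, [])
  | _ => (kept (-1) a, digit b (1 + Z.of_nat (Nat.min a 2)), [])
  end).

(** In column 1, digits 2 and 3 go to 21 * 5^b and 7 * 3^a * 5^b, while 7 * 5^b takes digit 4 in
    both classes 1 and 2 modulo 3. *)
Definition kind_7 : kind := Kind [7] (fun a b =>
  match b, a with
  | O, O => (0, 0, [0])
  | O, _ => (killed 1 a, 0, [1])
  | _, O => (0, digit b 4, [1])
  | _, _ => (kept 1 a, digit b (1 + Z.of_nat (Nat.min a 2)), [1])
  end).

(** At b = 0 the 23 exponents a give every residue modulo 23 at the end of the 3-chain; for
    exponents 1 to 8 of 5 the residues run over 0, ..., 23 at the ends of the 5-chains. *)
Definition kind_23 : kind := Kind [23] (fun a b =>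
  match b with
  | O => (-1, 0, [Z.of_nat a])
  | S b => (kept (-1) a, 0, [Z.of_nat (3 * b + Nat.min a 2)])
  end).

Definition kind_161 : kind := Kind [7; 23] (fun a b =>
  match b with
  | O => (1, 0, [1; Z.of_nat a])
  | S b => (kept 1 a, 0, [1; Z.of_nat (3 * b + Nat.min a 2)])
  end).

(** The index into the row follows the order 1, 3, 3^j, 5^i, 3 * 5^i, 3^j * 5^i of the
    multipliers. *)
Definition kind_table (t : list Z * list (list Z)) : kind := Kind (fst t) (fun a b =>
  (kept (-1) a, digit b 4,
   nth (Nat.min a 2 + match b with O => 0 | _ => 3 end) (snd t) [])).

Definition kinds : list kind :=
  [kind_1; kind_7; kind_23; kind_161] ++ map kind_table table.

Definition grid : list (nat * nat * kind) :=
  list_prod (list_prod (seq 0 23) (seq 0 9)) kinds.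

(** * Distinctness, parity and positivity of the moduli *)

Lemma size_eq a b k :
  size (a, b, k) = 3 ^ Z.of_nat a * (5 ^ Z.of_nat b * prod (factors k)).
Proof.
  unfold size, cell. destruct (place k a b) as [[r3 r5] rs]. simpl.
  now rewrite modulus_box.
Qed.

Fixpoint coprimeb (l : list Z) : bool :=
  match l with [] => true | m :: l => ((Z.gcd m (prod l) =? 1) && coprimeb l)%bool end.

Lemma coprimeb_spec l : coprimeb l = true -> pairwise_coprime l.
Proof.
  induction l as [|m l IH]; simpl; [easy|].
  intros H. apply Bool.andb_true_iff in H. destruct H as [H1 H2].
  split; [now apply Zgcd_1_rel_prime, Z.eqb_eq|auto].
Qed.

Lemma kinds_check :
  forallb (fun k => (coprimeb (3 :: 5 :: factors k) && Z.odd (prod (factors k))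
    && (0 <? prod (factors k)))%bool) kinds = true.
Proof. vm_compute. reflexivity. Qed.

Lemma kinds_spec k :
  In k kinds ->
  rel_prime 3 (prod (factors k)) /\ rel_prime 5 (prod (factors k)) /\
  pairwise_coprime (factors k) /\ Z.odd (prod (factors k)) = true /\ 0 < prod (factors k).
Proof.
  intros Hk. pose proof (proj1 (forallb_forall _ _) kinds_check k Hk) as H.
  cbv beta in H. rewrite !Bool.andb_true_iff in H. destruct H as [[Hc Ho] Hp].
  apply coprimeb_spec in Hc. destruct Hc as [H3 [H5 Hc]].
  split; [|split; [exact H5|split; [exact Hc|split; [exact Ho|now apply Z.ltb_lt]]]].
  apply rel_prime_sym, rel_prime_div with (prod (5 :: factors k)).
  - now apply rel_prime_sym.
  - apply Z.divide_factor_r.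
Qed.

Lemma rel_prime_3 b k :
  In k kinds -> rel_prime 3 (5 ^ Z.of_nat b * prod (factors k)).
Proof.
  intros Hk. apply rel_prime_mult; [|apply (kinds_spec k Hk)].
  apply rel_prime_Zpower_r; [lia|]. now apply Zgcd_1_rel_prime.
Qed.

Lemma size_inj a b k a' b' k' :
  In k kinds -> In k' kinds -> size (a, b, k) = size (a', b', k') ->
  a = a' /\ b = b' /\ prod (factors k) = prod (factors k').
Proof.
  intros Hk Hk' E. rewrite !size_eq in E.
  apply pow_mul_inj in E; [|lia|now apply rel_prime_3|now apply rel_prime_3].
  destruct E as [-> E].
  apply pow_mul_inj in E; [tauto|lia|apply (kinds_spec k Hk)|apply (kinds_spec k' Hk')].
Qed.

Lemma NoDup_kinds : NoDup (map (fun k => prod (factors k)) kinds).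
Proof.
  set (l := map _ _).
  assert (E : nodup Z.eq_dec l = l) by (vm_compute; reflexivity).
  rewrite <- E. apply NoDup_nodup.
Qed.

Lemma NoDup_list_prod (A B : Type) (l : list A) (l' : list B) :
  NoDup l -> NoDup l' -> NoDup (list_prod l l').
Proof.
  intros Hl Hl'. induction Hl as [|x l Hx Hl IH]; simpl; [constructor|].
  apply NoDup_app; [|exact IH|].
  - apply NoDup_map_NoDup_ForallPairs; [|exact Hl'].
    intros y y' _ _ E. now injection E.
  - intros [a b] H1 H2. apply in_map_iff in H1. destruct H1 as [y [E _]].
    injection E as <- <-. apply in_prod_iff in H2. now apply Hx.
Qed.

Lemma NoDup_grid : NoDup grid.
Proof.
  repeat apply NoDup_list_prod; try apply seq_NoDup.
  apply (NoDup_map_inv _ _ NoDup_kinds).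
Qed.

Lemma in_grid a b k :
  In (a, b, k) grid <-> ((a <= 22)%nat /\ (b <= 8)%nat /\ In k kinds).
Proof.
  unfold grid. rewrite !in_prod_iff, !in_seq. intuition lia.
Qed.

Lemma NoDup_sizes : NoDup (map size grid).
Proof.
  apply NoDup_map_NoDup_ForallPairs; [|exact NoDup_grid].
  intros [[a b] k] [[a' b'] k'] Hi Hi' E.
  apply in_grid in Hi, Hi'.
  destruct (size_inj a b k a' b' k') as [-> [-> Ep]]; try tauto.
  f_equal. pose proof NoDup_kinds as Hd.
  assert (Hk : In k kinds) by tauto. assert (Hk' : In k' kinds) by tauto.
  (* The parts m do not repeat, so equal parts come from the same kind. *)
  clear - Hd Hk Hk' Ep. induction kinds as [|c l IH]; [easy|].
  simpl in Hd. inversion Hd as [|? ? Hn Hd']; subst.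
  destruct Hk as [<-|Hk], Hk' as [<-|Hk']; auto.
  - exfalso. apply Hn. rewrite Ep. now apply in_map with (f := fun k => prod (factors k)).
  - exfalso. apply Hn. rewrite <- Ep. now apply in_map with (f := fun k => prod (factors k)).
Qed.

Lemma pairwise_coprime_cell i : In i grid -> pairwise_coprime (map modulus (cell i)).
Proof.
  destruct i as [[a b] k]. intros Hi. apply in_grid in Hi. destruct Hi as [_ [_ Hk]].
  unfold cell. destruct (place k a b) as [[r3 r5] rs]. simpl.
  rewrite modulus_box. split; [|split].
  - apply rel_prime_sym, rel_prime_Zpower_r, rel_prime_sym; [lia|]. now apply rel_prime_3.
  - apply rel_prime_sym, rel_prime_Zpower_r, rel_prime_sym; [lia|]. apply (kinds_spec k Hk).
  - apply (kinds_spec k Hk).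
Qed.

Lemma size_odd_pos i : In i grid -> Z.odd (size i) = true /\ 0 < size i.
Proof.
  destruct i as [[a b] k]. intros Hi. apply in_grid in Hi. destruct Hi as [_ [_ Hk]].
  destruct (kinds_spec k Hk) as [_ [_ [_ [Ho Hp]]]].
  rewrite size_eq, !Z.odd_mul, Ho. split.
  - assert (Hpow : forall q n, Z.odd q = true -> Z.odd (q ^ Z.of_nat n) = true).
    { intros q [|n] Hq; [reflexivity|]. rewrite Z.odd_pow; [exact Hq|lia]. }
    now rewrite !Hpow.
  - pose proof (Z.pow_pos_nonneg 3 (Z.of_nat a)). pose proof (Z.pow_pos_nonneg 5 (Z.of_nat b)).
    repeat apply Z.mul_pos_pos; lia.
Qed.

(** Size 1 is forbidden, and 21 is reserved for the five prescribed congruences. *)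
Definition admissible (i : nat * nat * kind) : bool :=
  (negb (size i =? 1) && negb (size i =? 21))%bool.

(** By [size_inj], sizes 1 and 21 determine the exponents and m; they are read off from [kind_1] and
    [kind_7]. *)
Lemma admissible_intro a b k :
  In k kinds -> ~ (prod (factors k) = 1 /\ a = 0%nat /\ b = 0%nat) ->
  ~ (prod (factors k) = 7 /\ a = 1%nat /\ b = 0%nat) -> admissible (a, b, k) = true.
Proof.
  intros Hk H1 H7. unfold admissible. apply Bool.andb_true_iff.
  split; apply Bool.negb_true_iff, Z.eqb_neq; intros E.
  - apply H1. change 1 with (size (0%nat, 0%nat, kind_1)) in E.
    apply size_inj in E; [|exact Hk|now left]. simpl in E. tauto.
  - apply H7. change 21 with (size (1%nat, 0%nat, kind_7)) in E.
    apply size_inj in E; [|exact Hk|now right; left]. simpl in E. tauto.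
Qed.

(** Keeps the table clear of the two excluded sizes, whose parts m are 1 and 7. *)
Lemma table_large : forallb (fun t => 7 <? prod (fst t)) table = true.
Proof. vm_compute. reflexivity. Qed.

(** * Every integer is covered *)

Definition hit (x : Z) : Prop :=
  exists i, In i grid /\ admissible i = true /\ Forall (satisfies x) (cell i).

Lemma hit_intro x a b k r3 r5 rs :
  (a <= 22)%nat -> (b <= 8)%nat -> In k kinds ->
  ~ (prod (factors k) = 1 /\ a = 0%nat /\ b = 0%nat) ->
  ~ (prod (factors k) = 7 /\ a = 1%nat /\ b = 0%nat) ->
  place k a b = (r3, r5, rs) ->
  (3 ^ Z.of_nat a | x - r3) -> (5 ^ Z.of_nat b | x - r5) ->
  Forall (satisfies x) (box (factors k) rs) -> hit x.
Proof.
  intros Ha Hb Hk H1 H7 E H3 H5 Hr. exists (a, b, k).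
  split; [now apply in_grid|]. split; [now apply admissible_intro|].
  unfold cell. rewrite E. now repeat constructor.
Qed.

(** [Nat.min a 2] numbers the multipliers 1, 3, 3^j alike for all j, so residues depending only on
    it are shared by all levels. *)
Lemma label_choice j n :
  (2 <= j)%nat -> (n < 3)%nat ->
  exists a, (a = 0 \/ a = 1 \/ a = j)%nat /\ Nat.min a 2 = n.
Proof.
  intros Hj Hn. destruct n as [|[|[|n]]]; [exists 0%nat|exists 1%nat|exists j|]; lia.
Qed.

(* Closes the 5-chain: 23 <= 3 * 8. *)
Lemma residue_23 x j :
  (2 <= j)%nat ->
  exists a b, (a = 0 \/ a = 1 \/ a = j)%nat /\ (b < 8)%nat /\
    (23 | x - Z.of_nat (3 * b + Nat.min a 2)).
Proof.
  intros Hj. pose proof (Z.mod_pos_bound x 23 ltac:(lia)) as Hb.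
  set (n := Z.to_nat (x mod 23)).
  pose proof (Nat.div_mod_eq n 3) as Hn.
  destruct (label_choice j (n mod 3) Hj) as [a [Ha E]].
  { now apply Nat.mod_upper_bound. }
  exists a, (n / 3)%nat. split; [exact Ha|]. rewrite E, <- Hn. split.
  - apply Nat.Div0.div_lt_upper_bound. lia.
  - unfold n. rewrite Z2Nat.id by lia. now apply divide_sub_mod.
Qed.

(** Killed classes fall to 3^j. In a kept class, digits 1, 2, 3 fall to 5^i, 3 * 5^i, 3^j * 5^i; at
    digit 4, column 1 falls to 7 * 5^i and the others to the table. The ends of both chains fall to
    [kind_23]. *)
Lemma hit_2_mod_3 x : (3 | x - -1) -> x mod 7 <> 0 -> hit x.
Proof.
  intros H3 H7.
  (* The argument 21 ends the chain at 3^22, the top power of 3 in the grid. *)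
  destruct (chain_3 x (-1) 21 H3) as [He|[j [Hj [Hk|Hk]]]].
  - pose proof (Z.mod_pos_bound x 23 ltac:(lia)) as Hb.
    apply (hit_intro x (Z.to_nat (x mod 23)) 0 kind_23 (-1) 0 [x mod 23]); simpl; try lia.
    + tauto.
    + now rewrite Z2Nat.id by lia.
    + apply power_below with 22%nat; [lia|lia|exact He].
    + apply Z.divide_1_l.
    + repeat constructor. now apply divide_sub_mod.
  - apply (hit_intro x j 0 kind_1 (killed (-1) j) 0 []); simpl; try lia.
    + now left.
    + reflexivity.
    + exact Hk.
    + apply Z.divide_1_l.
    + constructor.
  - pose proof (fun a => kept_below x (-1) j a H3 Hk) as Hkept.
    destruct (chain_5 x 8) as [He|[i [u [Hi [Hu H5]]]]].
    + destruct (residue_23 x j) as [a [b [Ha [Hb Hr]]]]; [lia|].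
      eapply (hit_intro x a (S b) kind_23); try (simpl; lia).
      * simpl; tauto.
      * reflexivity.
      * now apply Hkept.
      * apply power_below with 8%nat; [lia|lia|]. now rewrite Z.sub_0_r.
      * repeat constructor. exact Hr.
    + destruct (Z.eq_dec u 4) as [->|Hu4].
      * destruct (Z.eq_dec (x mod 7) 1) as [E7|E7].
        -- apply (hit_intro x 0 i kind_7 0 (digit i 4) [1]); try (simpl; lia).
           ++ simpl; tauto.
           ++ destruct i; [lia|reflexivity].
           ++ apply Z.divide_1_l.
           ++ exact H5.
           ++ repeat constructor. unfold satisfies; simpl. rewrite <- E7.
              now apply divide_sub_mod.
        -- pose proof (Z.mod_pos_bound x 7 ltac:(lia)) as Hb.
           destruct (table_met x) as [t [k [Ht [Hk6 Hx]]]]; [lia|].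
           pose proof (proj1 (forallb_forall _ _) table_large t Ht) as Hl.
           apply Z.ltb_lt in Hl.
           (* The remainder of k modulo 3 chooses the exponent of 3, the quotient whether 5^i is
              used. *)
           destruct (label_choice j (k mod 3)) as [a [Ha Ea]];
             [lia|now apply Nat.mod_upper_bound|].
           pose proof (Nat.div_mod_eq k 3) as Ek.
           pose proof (Nat.mod_upper_bound k 3 ltac:(lia)) as Hm.
           set (b := match (k / 3)%nat with O => O | _ => i end).
           apply (hit_intro x a b (kind_table t) (kept (-1) a) (digit b 4)
             (nth k (snd t) [])); try (simpl; lia).
           ++ unfold b. destruct (k / 3)%nat; lia.
           ++ apply in_or_app. right. now apply in_map.
           ++ simpl. do 2 f_equal. rewrite Ea. unfold b.
              destruct (k / 3)%nat as [|q]; [lia|]. destruct i; lia.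
           ++ now apply Hkept.
           ++ unfold b. destruct (k / 3)%nat; [apply Z.divide_1_l|exact H5].
           ++ exact Hx.
      * destruct (label_choice j (Z.to_nat (u - 1))) as [a [Ha Ea]]; [lia|lia|].
        apply (hit_intro x a i kind_1 (kept (-1) a) (digit i u) []); try (simpl; lia).
        -- now left.
        -- replace u with (1 + Z.of_nat (Nat.min a 2)) by lia. destruct i; [lia|reflexivity].
        -- now apply Hkept.
        -- exact H5.
        -- constructor.
Qed.

(** The same descent inside column 1, with moduli divisible by 7 except at digit 1. There 5^i, and
    at digit 4 the modulus 7 * 5^i, are shared with the class 2 modulo 3. *)
Lemma hit_1_mod_3 x : (3 | x - 1) -> x mod 7 = 1 -> hit x.
Proof.
  intros H3 E7.
  assert (H7 : (7 | x - 1)) by (rewrite <- E7 at 1; now apply divide_sub_mod).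
  destruct (chain_3 x 1 21 H3) as [He|[j [Hj [Hk|Hk]]]].
  - pose proof (Z.mod_pos_bound x 23 ltac:(lia)) as Hb.
    apply (hit_intro x (Z.to_nat (x mod 23)) 0 kind_161 1 0 [1; x mod 23]); simpl; try lia.
    + tauto.
    + now rewrite Z2Nat.id by lia.
    + apply power_below with 22%nat; [lia|lia|exact He].
    + apply Z.divide_1_l.
    + repeat constructor; [exact H7|now apply divide_sub_mod].
  - apply (hit_intro x j 0 kind_7 (killed 1 j) 0 [1]); try (simpl; lia).
    + simpl; tauto.
    + destruct j; [lia|reflexivity].
    + exact Hk.
    + apply Z.divide_1_l.
    + repeat constructor. exact H7.
  - pose proof (fun a => kept_below x 1 j a H3 Hk) as Hkept.
    destruct (chain_5 x 8) as [He|[i [u [Hi [Hu H5]]]]].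
    + destruct (residue_23 x j) as [a [b [Ha [Hb Hr]]]]; [lia|].
      eapply (hit_intro x a (S b) kind_161); try (simpl; lia).
      * simpl; tauto.
      * reflexivity.
      * now apply Hkept.
      * apply power_below with 8%nat; [lia|lia|]. now rewrite Z.sub_0_r.
      * repeat constructor; [exact H7|exact Hr].
    + assert (u = 1 \/ u = 4 \/ 2 <= u <= 3) as [-> | [-> | Hu']] by lia.
      * apply (hit_intro x 0 i kind_1 (-1) (digit i 1) []); try (simpl; lia).
        -- now left.
        -- destruct i; [lia|reflexivity].
        -- apply Z.divide_1_l.
        -- exact H5.
        -- constructor.
      * apply (hit_intro x 0 i kind_7 0 (digit i 4) [1]); try (simpl; lia).
        -- simpl; tauto.
        -- destruct i; [lia|reflexivity].
        -- apply Z.divide_1_l.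
        -- exact H5.
        -- repeat constructor. exact H7.
      * destruct (label_choice j (Z.to_nat (u - 1))) as [a [Ha Ea]]; [lia|lia|].
        apply (hit_intro x a i kind_7 (kept 1 a) (digit i u) [1]); try (simpl; lia).
        -- simpl; tauto.
        -- replace u with (1 + Z.of_nat (Nat.min a 2)) by lia.
           destruct i; [lia|]. destruct a; [lia|reflexivity].
        -- now apply Hkept.
        -- exact H5.
        -- repeat constructor. exact H7.
Qed.

(** Columns 2, 3, 4, 5, 6 modulo 7 of the class 1 modulo 3, in this order. *)
Definition fives : list congruence :=
  [Congruence 16 21; Congruence 10 21; Congruence 4 21; Congruence 19 21; Congruence 13 21].

Lemma fives_or_hit x : (exists c, In c fives /\ satisfies x c) \/ hit x.
Proof.
  destruct (Z.eq_dec (x mod 7) 0) as [E7|E7].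
  { right. apply (hit_intro x 0 0 kind_7 0 0 [0]); try (simpl; lia).
    - simpl; tauto.
    - reflexivity.
    - apply Z.divide_1_l.
    - apply Z.divide_1_l.
    - repeat constructor. unfold satisfies; simpl. rewrite <- E7. now apply divide_sub_mod. }
  pose proof (Z.mod_pos_bound x 3 ltac:(lia)) as Hb.
  pose proof (divide_sub_mod 3 x ltac:(lia)) as H3.
  assert (x mod 3 = 0 \/ x mod 3 = 2 \/ x mod 3 = 1) as [E | [E | E]] by lia; rewrite E in H3.
  (* The modulus 3 sits at [killed (-1) 1], which is 0. *)
  - right. apply (hit_intro x 1 0 kind_1 0 0 []); try (simpl; lia).
    + now left.
    + reflexivity.
    + exact H3.
    + apply Z.divide_1_l.
    + constructor.
  - right. apply hit_2_mod_3; [|exact E7].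
    replace (x - -1) with (x - 2 + 3) by ring.
    apply Z.divide_add_r; [exact H3|apply Z.divide_refl].
  - destruct (Z.eq_dec (x mod 7) 1) as [E1|E1]; [right; now apply hit_1_mod_3|left].
    pose proof (Z.mod_pos_bound x 7 ltac:(lia)) as H7.
    assert (Hc : exists r, In (Congruence r 21) fives /\ r mod 3 = 1 /\ r mod 7 = x mod 7).
    { assert (x mod 7 = 2 \/ x mod 7 = 3 \/ x mod 7 = 4 \/ x mod 7 = 5 \/ x mod 7 = 6)
        as [-> | [-> | [-> | [-> | ->]]]] by lia;
        [exists 16|exists 10|exists 4|exists 19|exists 13]; simpl; tauto. }
    destruct Hc as [r [Hr [Hr3 Hr7]]]. exists (Congruence r 21). split; [exact Hr|].
    unfold satisfies; simpl. change 21 with (3 * 7). apply rel_prime_mul_divide.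
    + now apply Zgcd_1_rel_prime.
    + apply Z.mod_divide; [lia|]. rewrite Zminus_mod, Hr3, E. reflexivity.
    + apply Z.mod_divide; [lia|]. rewrite Zminus_mod, Hr7, Z.sub_diag. reflexivity.
Qed.

(** * Assembly of the system *)

Lemma NoDup_map_filter (A B : Type) (f : A -> B) (p : A -> bool) (l : list A) :
  NoDup (map f l) -> NoDup (map f (filter p l)).
Proof.
  induction l as [|a l IH]; simpl; [auto|]. intros H. inversion H as [|? ? Ha Hl]; subst.
  destruct (p a); simpl; [|auto]. constructor; [|auto].
  intros Hin. apply Ha. apply in_map_iff in Hin. destruct Hin as [b [<- Hb]].
  apply filter_In in Hb. now apply in_map.
Qed.

Lemma filter_true (A : Type) (p : A -> bool) (l : list A) :
  (forall a, In a l -> p a = true) -> filter p l = l.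
Proof.
  induction l as [|a l IH]; intros H; simpl; [reflexivity|].
  rewrite (H a) by now left. f_equal. apply IH. intros; apply H; now right.
Qed.

Lemma filter_false (A : Type) (p : A -> bool) (l : list A) :
  (forall a, In a l -> p a = false) -> filter p l = [].
Proof.
  induction l as [|a l IH]; intros H; simpl; [reflexivity|].
  rewrite (H a) by now left. apply IH. intros; apply H; now right.
Qed.

Theorem theorem2p7 :
  exists s : list congruence,
    covering_system s /\
    (forall c, In c s -> Z.Odd (modulus c) /\ 1 < modulus c) /\
    length (filter (fun c => modulus c =? 21) s) = 5%nat /\
    NoDup (map modulus (filter (fun c => negb (modulus c =? 21)) s)).
Proof.
  destruct (chinese_remainder_map _ cell (filter admissible grid)) as [s [Es Hs]].
  { intros i Hi. apply filter_In in Hi. now apply pairwise_coprime_cell. }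
  assert (Hnd : NoDup (map modulus s)).
  { rewrite Es. apply NoDup_map_filter, NoDup_sizes. }
  assert (Hm : forall c, In c s ->
    Z.odd (modulus c) = true /\ 1 < modulus c /\ modulus c <> 21).
  { intros c Hc. apply (in_map modulus) in Hc. rewrite Es in Hc.
    apply in_map_iff in Hc. destruct Hc as [i [<- Hi]]. apply filter_In in Hi.
    destruct Hi as [Hi Ha]. destruct (size_odd_pos i Hi) as [Ho Hp].
    unfold admissible in Ha. apply Bool.andb_true_iff in Ha.
    rewrite !Bool.negb_true_iff, !Z.eqb_neq in Ha. fold (size i). intuition lia. }
  exists (fives ++ s). repeat split.
  - intros c Hc. apply in_app_iff in Hc. destruct Hc as [Hc|Hc].
    + simpl in Hc. intuition (subst; reflexivity).
    + destruct (Hm c Hc). lia.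
  - rewrite map_app. apply NoDup_app.
    + repeat constructor; simpl; intuition discriminate.
    (* Distinct moduli already make the residue classes distinct. *)
    + apply (NoDup_map_inv snd). now rewrite map_map.
    + intros y Hy Hy'. apply in_map_iff in Hy'. destruct Hy' as [c [<- Hc]].
      apply (Hm c Hc). apply (in_map snd) in Hy. simpl in Hy. intuition.
  - intros x. destruct (fives_or_hit x) as [[c [Hc Hx]]|[i [Hi [Ha Hx]]]].
    + exists c. split; [apply in_or_app; now left|exact Hx].
    + destruct (Hs x i) as [c [Hc Hcx]]; [apply filter_In; exact (conj Hi Ha)|exact Hx|].
      exists c. split; [apply in_or_app; now right|exact Hcx].
  - apply Z.odd_spec. apply in_app_iff in H. destruct H as [H|H].
    + simpl in H. intuition (subst; reflexivity).
    + now apply Hm.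
  - apply in_app_iff in H. destruct H as [H|H].
    + simpl in H. intuition (subst; reflexivity).
    + now apply Hm.
  - rewrite filter_app, (filter_false _ _ s), app_nil_r; [reflexivity|].
    intros c Hc. apply Z.eqb_neq. now apply Hm.
  - rewrite filter_app, (filter_true _ _ s); [exact Hnd|].
    intros c Hc. apply Bool.negb_true_iff, Z.eqb_neq. now apply Hm.
Qed.
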